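(* Let $\alpha,\beta\in\mathbb{R}$ satisfy $0\le\alpha\le1$, $\beta>0$ and $\alpha\beta+\frac1{2\beta}\le1$, and let $$R(z)=\frac{-2+(2\alpha\beta^2-2\alpha\beta+1)z^2-2\beta(\alpha-1)z}{2\,(1+(\alpha\beta-1)z)(\beta z-1)}.$$ Let $\mathbb{C}^-=\{z\in\mathbb{C}\mid \operatorname{Re}(z)\le0\}$. Then: (a) If $\alpha>\frac1{2\beta}$, the set $\{z\in\mathbb{C}^-\mid |R(z)|\le1\}$ is bounded. (b) If $\alpha<\frac1{2\beta}$ and $(\alpha,\beta)\ne(0,\frac12)$, then $|R(z)|<1$ for all $z\in\mathbb{C}^-\setminus\{0\}$. (c) If $\alpha=\frac1{2\beta}$ or $(\alpha,\beta)=(0,\frac12)$, then $|R(z)|<1$ for all $z$ with $\operatorname{Re}(z)<0$, and $|R(z)|=1$ whenever $\operatorname{Re}(z)=0$.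
   Context: $R$ is a rational function of the complex variable $z$ (the stability function of the second order SSPMPRK2($\alpha,\beta$) scheme). *)

(* Defs.v *)
From mathcomp Require Import all_boot all_order all_algebra.
From mathcomp Require Import complex.
From mathcomp Require Import all_classical all_reals all_analysis.

Set Implicit Arguments.
Unset Strict Implicit.
Unset Printing Implicit Defensive.

Import Order.TTheory GRing.Theory Num.Theory.
Import numFieldNormedType.Exports.

Local Open Scope classical_set_scope.
Local Open Scope ring_scope.
Local Open Scope complex_scope.

(* Division is total ([x / 0 = 0]).  Under the standing assumptions
   [0 < beta] and [alpha * beta + (2 * beta)^-1 <= 1] the two poles
   [1 / beta] and [1 / (1 - alpha * beta)] are real and positive, so this
   convention is never used on the closed left half-plane. *)
Definition stability_function (R : realType) (alpha beta : R) (z : R[i]) :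
    R[i] :=
  let a := alpha%:C in let b := beta%:C in
  (- 2 + (2 * a * b ^+ 2 - 2 * a * b + 1) * z ^+ 2 - 2 * b * (a - 1) * z)
    / (2 * (1 + (a * b - 1) * z) * (b * z - 1)).

Definition left_half_plane (R : realType) : set R[i] :=
  [set z | complex.Re z <= 0].

(* Main.v *)
(** Write [z = x + iy] and [s = |z|^2].  With [D] and [N] the denominator and
    the numerator of the stability function, [(|D|^2 - |N|^2) / 4] is
    [-2 x + 4 E x^2 - 2 G x s + (1 - 2 a b) (b - 1/2) E s^2] with [E > 0] and
    [G >= 0]: the linear terms in [s] cancel.  On the left half-plane the first
    three terms are nonnegative, and the sign of the quartic coefficient
    separates the three cases; when it is negative the quartic term dominates
    at infinity, the others being of order at most three in [|z|]. *)

Require Import Defs.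
From mathcomp Require Import all_boot all_order all_algebra.
From mathcomp Require Import ring lra.
From mathcomp Require Import complex.
From mathcomp Require Import all_classical all_reals all_analysis.

Set Implicit Arguments.
Unset Strict Implicit.
Unset Printing Implicit Defensive.

Import Order.TTheory GRing.Theory Num.Theory.
Import numFieldNormedType.Exports.

Local Open Scope classical_set_scope.
Local Open Scope ring_scope.
Local Open Scope complex_scope.

Section StabilityGap.
Variable R : realType.
Implicit Types (alpha beta x y : R) (z : R[i]).

(** The coefficient E of the expansion above; [gap_cubic] is G. *)
Definition gap_scale alpha beta := beta * (1 - alpha) + 1 / 2.

Definition gap_cubic alpha beta :=
  (beta + 1 - alpha * beta) * (beta - alpha * beta ^+ 2)
  + beta * (1 - alpha) * (alpha * beta ^+ 2 - alpha * beta + 1 / 2).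

Definition gap_quartic alpha beta :=
  (1 - 2 * alpha * beta) * (beta - 1 / 2) * gap_scale alpha beta.

Definition stability_gap alpha beta x y :=
  - 2 * x + 4 * gap_scale alpha beta * x ^+ 2
  - 2 * gap_cubic alpha beta * x * (x ^+ 2 + y ^+ 2)
  + gap_quartic alpha beta * (x ^+ 2 + y ^+ 2) ^+ 2.

Definition stability_num alpha beta z : R[i] :=
  - 2 + (2 * alpha%:C * beta%:C ^+ 2 - 2 * alpha%:C * beta%:C + 1) * z ^+ 2
  - 2 * beta%:C * (alpha%:C - 1) * z.

Definition stability_den alpha beta z : R[i] :=
  2 * (1 + (alpha%:C * beta%:C - 1) * z) * (beta%:C * z - 1).

Lemma stability_functionE alpha beta z :
  stability_function alpha beta z
  = stability_num alpha beta z / stability_den alpha beta z.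
Proof. by []. Qed.

Lemma normc_gap alpha beta x y :
  `|stability_den alpha beta (x +i* y)| ^+ 2
  - `|stability_num alpha beta (x +i* y)| ^+ 2
  = (4 * stability_gap alpha beta x y)%:C.
Proof.
rewrite -!add_Re2_Im2 -rmorphB; congr (_%:C).
(* The numeral 2 becomes an embedded real, so that [simpc] can split everything into real and
   imaginary parts. *)
rewrite /stability_den /stability_num (_ : 2 = 2%:C :> R[i]) ?rmorph_nat //.
rewrite ![_%:C ^+ 2]expr2 ![(_ +i* _) ^+ 2]expr2; simpc => /=.
rewrite /stability_gap /gap_quartic /gap_cubic /gap_scale; by field.
Qed.

Section LeftHalfPlane.
Variables (alpha beta : R).
Hypotheses (halpha : 0 <= alpha <= 1) (hbeta : 0 < beta).
Hypothesis hab : alpha * beta + 1 / (2 * beta) <= 1.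

Let hinv : 0 < 1 / (2 * beta).
Proof. by rewrite divr_gt0 // mulr_gt0. Qed.

Let hinvM : beta * (1 / (2 * beta)) = 1 / 2.
Proof. by field; rewrite gt_eqF. Qed.

Let hprod : 0 <= alpha * beta.
Proof. by case/andP: halpha => ? _; rewrite mulr_ge0 // ltW. Qed.

(** As [alpha * beta] is nonnegative, [hab] gives [1 / (2 * beta) <= 1]; multiply by [beta]. *)
Lemma beta_ge_half : 1 / 2 <= beta.
Proof. by move: hinv hinvM hprod hab hbeta; nra. Qed.

(** Hence [beta = 1 / 2] leaves only [alpha = 0], the exceptional pair of (b) and (c). *)
Lemma beta_gt_half : 0 < alpha -> 1 / 2 < beta.
Proof.
move=> ha; have : 0 < alpha * beta by rewrite mulr_gt0.
by move: hinv hinvM hab hbeta; nra.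
Qed.

Lemma gap_scale_gt0 : 0 < gap_scale alpha beta.
Proof.
case/andP: halpha => _ h; have : 0 <= beta * (1 - alpha).
  by rewrite mulr_ge0 ?subr_ge0 // ltW.
by rewrite /gap_scale; lra.
Qed.

(** Only the factor [alpha * beta * (beta - 1) + 1 / 2] has an unclear sign. It is positive for
    [beta >= 1]; for [beta < 1], [hab] forces [alpha * beta <= 1 / 2], which bounds the negative
    part. *)
Lemma gap_cubic_ge0 : 0 <= gap_cubic alpha beta.
Proof.
case/andP: halpha => ha0 ha1; have hb := ltW hbeta.
have hq : 0 <= 1 - alpha * beta by move: hinv hab; lra.
have hm : 0 <= beta + 1 - alpha * beta by lra.
have hd : 0 <= beta - alpha * beta ^+ 2.
  by rewrite (_ : _ - _ = beta * (1 - alpha * beta)) ?mulr_ge0 //; ring.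
have hn : 0 <= beta * (1 - alpha) by rewrite mulr_ge0 ?subr_ge0.
rewrite /gap_cubic addr_ge0 ?(mulr_ge0 hm) // (mulr_ge0 hn) //.
have [b1|b1] := leP 1 beta.
  have : 0 <= alpha * beta * (beta - 1) by rewrite mulr_ge0 ?subr_ge0.
  by lra.
have hi : 1 / 2 <= 1 / (2 * beta) by move: hinv hinvM; nra.
have h2 : alpha * beta <= 1 / 2 by move: hab hi; lra.
have : alpha * beta * (1 - beta) <= alpha * beta by rewrite ler_piMr //; lra.
by lra.
Qed.

(** On the left half-plane the two linear factors have real parts at least 1 and at most -1. *)
Lemma stability_den_neq0 x y : x <= 0 ->
  stability_den alpha beta (x +i* y) != 0.
Proof.
move=> hx; have hb : beta * x <= 0 by rewrite mulr_ge0_le0 // ltW.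
have hq : 0 <= (alpha * beta - 1) * x.
  by rewrite mulr_le0 //; move: hinv hab; lra.
rewrite /stability_den !mulf_neq0 ?pnatr_eq0 //; apply/negP => /eqP.
  by move=> /(congr1 (@complex.Re R)); simpc => /=; lra.
by move=> /(congr1 (@complex.Re R)); simpc => /=; lra.
Qed.

Lemma stability_le1 x y : x <= 0 ->
  (`|stability_function alpha beta (x +i* y)| <= 1)
  = (0 <= stability_gap alpha beta x y).
Proof.
move=> hx; have hD : 0 < `|stability_den alpha beta (x +i* y)|.
  by rewrite normr_gt0 stability_den_neq0.
rewrite stability_functionE normf_div ler_pdivrMr // mul1r.
rewrite -(ler_pXn2r (n := 2)) ?nnegrE // -subr_ge0 normc_gap ler0c.
by rewrite pmulr_rge0.
Qed.

Lemma stability_lt1 x y : x <= 0 ->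
  (`|stability_function alpha beta (x +i* y)| < 1)
  = (0 < stability_gap alpha beta x y).
Proof.
move=> hx; have hD : 0 < `|stability_den alpha beta (x +i* y)|.
  by rewrite normr_gt0 stability_den_neq0.
rewrite stability_functionE normf_div ltr_pdivrMr // mul1r.
rewrite -(ltr_pXn2r (n := 2)) ?nnegrE // -subr_gt0 normc_gap.
by rewrite -[0]/(0%:C) ltcR pmulr_rgt0.
Qed.

Lemma stability_gap_bound x y : x <= 0 -> 0 <= stability_gap alpha beta x y ->
  - gap_quartic alpha beta * (x ^+ 2 + y ^+ 2) ^+ 2
  <= - 2 * x + 4 * gap_scale alpha beta * x ^+ 2
     - 2 * gap_cubic alpha beta * x * (x ^+ 2 + y ^+ 2).
Proof. by rewrite /stability_gap; lra. Qed.

(** For [x < 0] the term [- 2 * x] is positive and the others are nonnegative; on the imaginary axis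
    only the quartic term survives. *)
Lemma stability_gap_gt0 x y : 0 <= gap_quartic alpha beta ->
  x < 0 \/ x = 0 /\ 0 < gap_quartic alpha beta * (y ^+ 2) ^+ 2 ->
  0 < stability_gap alpha beta x y.
Proof.
move=> hQ [hx|[-> hy]]; last by rewrite /stability_gap; lra.
have h1 : 0 <= gap_scale alpha beta * x ^+ 2.
  by rewrite mulr_ge0 ?sqr_ge0 // ltW // gap_scale_gt0.
have hs : 0 <= x ^+ 2 + y ^+ 2 by rewrite addr_ge0 ?sqr_ge0.
have h2 : 0 <= gap_cubic alpha beta * - x * (x ^+ 2 + y ^+ 2).
  by rewrite !mulr_ge0 ?gap_cubic_ge0 // oppr_ge0 ltW.
have h3 : 0 <= gap_quartic alpha beta * (x ^+ 2 + y ^+ 2) ^+ 2.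
  by rewrite mulr_ge0 ?sqr_ge0.
by rewrite /stability_gap; lra.
Qed.

Lemma stability_region_bounded :
  gap_quartic alpha beta < 0 ->
  bounded_set [set z : R[i]^o | left_half_plane z /\
                                `|stability_function alpha beta z| <= 1].
Proof.
set k := gap_quartic _ _ => hk.
(* [C] sums the coefficients of the three lower terms, each of which is at most its coefficient
   times [r ^+ 3] once [r >= 1]. *)
set C := 2 + 4 * gap_scale alpha beta + 2 * gap_cubic alpha beta.
have hC : 0 < C.
  by move: gap_scale_gt0 gap_cubic_ge0; rewrite /C; lra.
(* The summand 1 covers the points of modulus at most 1, and [C / - k] the others. The bound lives
   in [R[i]], so it must be shown real. *)
exists (1 + C / - k)%:C; split; first by apply/complex_realP; eexists.
move=> M hM [x y] [/= hRe]; have {hRe} hx : x <= 0 := hRe.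
rewrite stability_le1 // => hg.
apply: le_trans (ltW hM); rewrite normc_def lecR /=.
set s := x ^+ 2 + y ^+ 2; set r := Num.sqrt s.
have hs : 0 <= s by rewrite addr_ge0 ?sqr_ge0.
have hr : 0 <= r by rewrite sqrtr_ge0.
have sE : s = r ^+ 2 by rewrite sqr_sqrtr.
have hxr : - x <= r.
  by rewrite -ler0_norm // -sqrtr_sqr ler_wsqrtr // /s lerDl sqr_ge0.
have hCk : 0 <= C / - k by rewrite divr_ge0 ?oppr_ge0 // ltW.
have [r1|/ltW r1] := leP r 1; first by lra.
suff : r <= C / - k by lra.
rewrite ler_pdivlMr ?oppr_gt0 //.
have r3 : 0 < r ^+ 3 by rewrite exprn_gt0 // (lt_le_trans ltr01).
(* Multiplying by [r ^+ 3] turns the left side into [- k * s ^+ 2], the quantity bounded by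
   [stability_gap_bound]. *)
rewrite -(ler_pM2r r3).
have := stability_gap_bound hx hg; rewrite -/k -/s sE.
have e1 : - x <= r ^+ 3.
  by apply: le_trans hxr _; rewrite -[leLHS]expr1 ler_weXn2l.
have e2 : x ^+ 2 <= r ^+ 3.
  apply: (@le_trans _ _ (r ^+ 2)); last by rewrite ler_weXn2l.
  by rewrite -sE /s lerDl sqr_ge0.
have e3 : - x * r ^+ 2 <= r ^+ 3.
  by rewrite [leRHS]exprS ler_wpM2r ?sqr_ge0.
have f2 := ler_wpM2l (ltW gap_scale_gt0) e2.
have f3 := ler_wpM2l gap_cubic_ge0 e3.
rewrite (_ : r * - k * r ^+ 3 = - k * (r ^+ 2) ^+ 2); last by ring.
by rewrite /C; lra.
Qed.

End LeftHalfPlane.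
End StabilityGap.

Theorem proposition3p2 (R : realType) (alpha beta : R)
    (halpha : 0 <= alpha <= 1) (hbeta : 0 < beta)
    (hab : alpha * beta + 1 / (2 * beta) <= 1) :
  [/\ alpha > 1 / (2 * beta) ->
        bounded_set [set z : R[i]^o | left_half_plane z /\
                                      `|stability_function alpha beta z| <= 1],
      alpha < 1 / (2 * beta) -> (alpha, beta) <> (0, 1 / 2) ->
        forall z : R[i], left_half_plane z -> z <> 0 ->
          `|stability_function alpha beta z| < 1
    & alpha = 1 / (2 * beta) \/ (alpha, beta) = (0, 1 / 2) ->
        (forall z : R[i], complex.Re z < 0 ->
           `|stability_function alpha beta z| < 1) /\
        (forall z : R[i], complex.Re z = 0 ->
           `|stability_function alpha beta z| = 1)].
Proof.
have hmul : beta * (1 / (2 * beta)) = 1 / 2 by field; rewrite gt_eqF.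
have hE := gap_scale_gt0 halpha hbeta.
have hb := beta_ge_half halpha hbeta hab.
have ha0 : 0 <= alpha by case/andP: halpha.
split.
- move=> ha; apply: stability_region_bounded => //.
  have hinv : 0 < 1 / (2 * beta) by rewrite divr_gt0 // mulr_gt0.
  have hb' : 1 / 2 < beta by apply: beta_gt_half hab _ => //; apply: lt_trans ha.
  have h : 1 / 2 < alpha * beta by rewrite -hmul mulrC ltr_pM2r.
  by rewrite /gap_quartic !nmulr_rlt0 //; lra.
- move=> ha hne [x y] hRe hz; have {hRe} hx : x <= 0 := hRe.
  have h : alpha * beta < 1 / 2 by rewrite -hmul mulrC ltr_pM2l.
  have hb' : 1 / 2 < beta.
    (* If [beta = 1 / 2], a positive [alpha] contradicts [beta_gt_half], and [alpha = 0] is the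
       excluded pair. *)
    rewrite lt_neqAle hb andbT; apply/eqP => bE.
    have [a0|/(beta_gt_half hbeta hab)] := leP alpha 0; last by lra.
    by apply: hne; rewrite bE; congr (_, _); apply/eqP; rewrite eq_le a0.
  have hQ : 0 < gap_quartic alpha beta.
    by rewrite /gap_quartic !mulr_gt0 //; lra.
  rewrite stability_lt1 //; apply: stability_gap_gt0 => //; first exact: ltW.
  move: hx; rewrite le_eqVlt => /orP[/eqP x0|]; [right|by left].
  split=> //; rewrite mulr_gt0 // !exprn_even_gt0 //= sqrf_eq0.
  by apply/eqP => y0; apply: hz; rewrite x0 y0.
- move=> hc; have hQ : gap_quartic alpha beta = 0.
    (* Each alternative kills one factor: [1 - 2 * alpha * beta] or [beta - 1 / 2]. *)
    rewrite /gap_quartic; case: hc => [aE|[-> ->]]; last by ring.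
    have -> : 1 - 2 * alpha * beta = 0 by rewrite aE; move: hmul; lra.
    by rewrite !mul0r.
  split=> -[x y] /= hx.
    rewrite (stability_lt1 hbeta hab _ (ltW hx)).
    apply: stability_gap_gt0 => //; last by left.
    by rewrite hQ.
  have g0 : stability_gap alpha beta x y = 0.
    by rewrite /stability_gap hQ hx; ring.
  have hx0 : x <= 0 by rewrite hx.
  apply/eqP; rewrite eq_le stability_le1 // g0 lexx /=.
  (* The order on [R[i]] is partial, so trading [1 <= _] for a negated strict inequality requires
     both sides to be real. *)
  by rewrite real_leNgt ?normr_real ?real1 // stability_lt1 // g0 ltxx.
Qed.
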